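(* Let $\alpha,\beta$ be real and $n\ge0$ an integer such that the HR polynomials below are well-defined. Let $$L_1=z(1-z)\partial_z^2+(1-\beta-(2+\alpha)z)\partial_z,\qquad L_2=(1-z)\partial_z-(\alpha+1)I.$$ The generalized eigenvalue problem $L_1\phi=\theta L_2\phi$ has the following two classes of quasi-Laurent-polynomial eigenfunctions: for $j=3,4$, $$(L_1-\theta^{(j)}_nL_2)\phi^{(j,n)}(z)=0,\qquad \phi^{(j,n)}(z)=\xi_j(z)p^{(j)}_n(z),$$ where $$\xi_3(z)=(-z)^{-1-\alpha},\quad p^{(3)}_n(z)=P_n(z^{-1};\alpha,\beta),\quad \theta^{(3)}_n=-n-1-\alpha-\beta;$$ $$\xi_4(z)=(-z)^{-1+\beta}(1-z)^{-\alpha-\beta},\quad p^{(4)}_n(z)=P_n(z^{-1};-\beta,-\alpha),\quad\theta^{(4)}_n=-n-1.$$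
   Context: HR polynomials: $P_n(z;a,b)=\frac{(b)_n}{(a+1)_n}\,{}_2F_1(-n,a+1;1-b-n;z)$, $(a)_n$ the Pochhammer symbol; well-defined when $(a+1)_n\ne0$ and $b\notin\{0,-1,\ldots,1-n\}$. $\partial_z=d/dz$. A quasi-Laurent-polynomial eigenfunction is an eigenfunction that is a product of a gauge function and a Laurent polynomial. Powers are taken with any fixed holomorphic branch on a domain avoiding the branch points. *)

(* Defs.v *)
From mathcomp Require Import all_boot all_order all_algebra.
From mathcomp Require Import complex.
From mathcomp Require Import all_classical all_reals all_analysis.

Set Implicit Arguments.
Unset Strict Implicit.
Unset Printing Implicit Defensive.

Import Order.TTheory GRing.Theory Num.Theory.
Import numFieldNormedType.Exports.

Local Open Scope ring_scope.
Local Open Scope complex_scope.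
Local Open Scope classical_set_scope.

Section HRPolynomials.
Variable F : fieldType.
Implicit Types (a b c : F) (n k : nat).

Definition pochhammer a n : F := \prod_(i < n) (a + i%:R).

(* The terminating series 2F1(-n, b; c; z): (-n)_k vanishes for k > n. *)
Definition hyp2F1_neg n b c : {poly F} :=
  \poly_(k < n.+1) (pochhammer (- n%:R) k * pochhammer b k
                    / (pochhammer c k * k`!%:R)).

Definition HR_poly n a b : {poly F} :=
  (pochhammer b n / pochhammer (a + 1) n)
    *: hyp2F1_neg n (a + 1) (1 - b - n%:R).

Definition HR_well_defined n a b : Prop :=
  pochhammer (a + 1) n <> 0 /\ (forall k, (k < n)%N -> b <> - k%:R).

End HRPolynomials.

(* Typing the complex field as a numFieldType (rather than as the bare R[i])
   equips it with its norm topology, so that [derivable _ z 1] and [^`()] are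
   complex differentiability and the complex derivative. *)
Definition Cplx (R : realType) : numFieldType := R[i].

Definition RtoC (R : realType) (x : R) : Cplx R := x%:C.

Section ComplexDomains.
Variable R : realType.
Local Notation C := (Cplx R).
Implicit Types (D : set C) (f g phi : C -> C) (z w : C).

Definition cexp w : C :=
  let: x +i* y := w in (expR x * cos y) +i* (expR x * sin y).

Definition complex_domain D : Prop := [/\ D !=set0, open D & connected D].

Definition holomorphic_on D f : Prop := forall z, D z -> derivable f z 1.

(* f is a holomorphic branch of g^s on D: at each point it takes one of the
   values exp(s w), where w is a logarithm of g(z).  No holomorphic logarithm
   of g on D is required, so D may, e.g., surround 0 when s is an integer. *)
Definition power_branch D g (s : R) f : Prop :=
  holomorphic_on D f /\
  forall z, D z -> exists w, cexp w = g z /\ f z = cexp (RtoC s * w).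

Definition gauge_function D f : Prop :=
  holomorphic_on D f /\ forall z, D z -> f z <> 0.

Definition Laurent_polynomial f : Prop :=
  exists (m : nat) (q : {poly C}), forall z, z != 0 -> f z = q.[z] / z ^+ m.

(* Twice differentiability is part of the definition because [^`()] is total
   and takes a default value where the derivative does not exist. *)
Definition generalized_eigenfunction D (A B : (C -> C) -> C -> C)
    (theta : C) phi : Prop :=
  [/\ holomorphic_on D phi /\ holomorphic_on D phi^`(),
      exists2 z, D z & phi z <> 0
    & forall z, D z -> A phi z - theta * B phi z = 0].

Definition quasi_Laurent_eigenfunction D (A B : (C -> C) -> C -> C)
    (theta : C) (xi p : C -> C) : Prop :=
  [/\ gauge_function D xi, Laurent_polynomial p
    & generalized_eigenfunction D A B theta (fun z => xi z * p z)].

Definition L1 (alpha beta : R) phi : C -> C := fun z =>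
  z * (1 - z) * phi^`()^`()%classic z
  + (1 - RtoC beta - (2 + RtoC alpha) * z) * phi^`()%classic z.

Definition L2 (alpha : R) phi : C -> C := fun z =>
  (1 - z) * phi^`()%classic z - (RtoC alpha + 1) * phi z.

End ComplexDomains.

(* Main.v *)
Require Import Defs.
From mathcomp Require Import all_boot all_order all_algebra.
From mathcomp Require Import complex ring.
From mathcomp Require Import all_classical all_reals all_analysis.
Import Order.TTheory GRing.Theory Num.Theory.
Import numFieldNormedType.Exports.
Local Open Scope classical_set_scope.
Local Open Scope ring_scope.

(** With w = 1/z, the operator L_1 - theta L_2 applied to xi(z) P(1/z) equals
    -xi(z)/z times the hypergeometric operator with parameters -n, a+1, 1-b-n
    applied to P at w, and that operator annihilates the HR polynomial; only
    the logarithmic derivative of xi enters the computation.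
    To obtain it for a pointwise branch f of g^s, no logarithm of g is chosen:
    since s is real, |f|^2 = |g|^(2s), and differentiating this real identity
    along the lines through z in all complex directions v gives
    Re(conj(f) f' v) = s |f|^2 Re(g' v / g), whence f' = s (g'/g) f. *)

Local Notation Re := complex.Re.
Local Notation Im := complex.Im.

(** * Terminating hypergeometric series and their differential equation *)

Lemma pochhammerS (F : fieldType) (a : F) n :
  pochhammer a n.+1 = pochhammer a n * (a + n%:R).
Proof. by rewrite /pochhammer big_ord_recr. Qed.

Lemma pochhammer_neq0 (F : fieldType) (a : F) n :
  (forall k, (k < n)%N -> a + k%:R != 0) -> pochhammer a n != 0.
Proof. by move=> a0; apply/prodf_neq0 => i _; exact: a0. Qed.

(** This is the ratio of consecutive terms of the series, with denominators cleared. Only $(c)_k$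
    with $k\le n$ occurs, hence the bound on [j]. At [k = n] the factor [k%:R - n%:R] vanishes, and
    beyond [n] both coefficients are zero. *)
Lemma hyp2F1_neg_coef_rec (F : numFieldType) n (b c : F) k :
  (forall j, (j < n)%N -> c + j%:R != 0) ->
  k.+1%:R * (c + k%:R) * (hyp2F1_neg n b c)`_k.+1
  = (k%:R - n%:R) * (b + k%:R) * (hyp2F1_neg n b c)`_k.
Proof.
move=> c0; rewrite /hyp2F1_neg !coef_poly !ltnS.
have [kn|kn|->] := ltngtP k n; last 2 first.
- by rewrite !mulr0.
- by rewrite subrr !mul0r mulr0.
have pk0 : pochhammer c k != 0.
  by apply: pochhammer_neq0 => j jk; apply: c0; exact: ltn_trans kn.
rewrite !pochhammerS factS natrM.
field.
by rewrite pk0 c0 // nat1r !pnatr_eq0 -lt0n fact_gt0.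
Qed.

(** The coefficient of ['X^k] on the left is the difference of the two sides of the recurrence at
    [k]. *)
Lemma hyp2F1_neg_ode (F : numFieldType) n (b c : F) :
  (forall j, (j < n)%N -> c + j%:R != 0) ->
  let p := hyp2F1_neg n b c in
  'X * (1 - 'X) * p^`()^`() + (c%:P - (b + 1 - n%:R)%:P * 'X) * p^`()
  + (n%:R * b)%:P * p = 0.
Proof.
move=> c0 p; apply/polyP => k.
have := @hyp2F1_neg_coef_rec F n b c k c0; rewrite -/p => rec.
rewrite mulrBr mulr1 !mulrBl -!mulrA.
rewrite !(coefD, coefB, coefN, coefCM, coefXM) !coef_deriv coef0.
(* The factors $X$ and $X^2$ shift indices, so some terms are absent in degrees 0 and 1. *)
case: k rec => [|[|k]] /= rec; rewrite ?coef_deriv.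
- transitivity (1%:R * (c + 0%:R) * p`_1
    - (0%:R - n%:R) * (b + 0%:R) * p`_0); first by ring.
  by rewrite rec subrr.
- transitivity (2%:R * (c + 1%:R) * p`_2
    - (1%:R - n%:R) * (b + 1%:R) * p`_1); first by ring.
  by rewrite rec subrr.
- transitivity (k.+3%:R * (c + k.+2%:R) * p`_k.+3
    - (k.+2%:R - n%:R) * (b + k.+2%:R) * p`_k.+2); first by ring.
  by rewrite rec subrr.
Qed.

(** * Derivatives of $\xi(z)P(1/z)$ *)

Lemma is_derive_invr (K : numFieldType) (x : K) :
  x != 0 -> is_derive x 1 (fun y => y^-1) (- x ^- 2).
Proof.
move=> x0; apply: DeriveDef; first exact: derivableV (@derivable_id _ _ _ _).
by rewrite (@deriveV _ _ id) ?derive_id ?[_ *: 1]mulr1.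
Qed.

Lemma is_derive_horner_inv (K : numFieldType) (p : {poly K}) (x : K) :
  x != 0 ->
  is_derive x 1 (fun y => p.[y^-1]) (- p^`().[x^-1] / x ^+ 2).
Proof.
move=> x0; have dV := is_derive_invr _ _ x0.
elim/poly_ind: p => [|p r ih].
  rewrite (_ : (fun _ => _) = cst 0); last first.
    by apply/funext => y; rewrite horner0.
  by apply: is_derive_eq; rewrite deriv0 horner0 oppr0 mul0r.
rewrite (_ : (fun _ => _) = (fun y => p.[y^-1]) * (fun y => y^-1) + cst r); last first.
  by apply/funext => y; rewrite !hornerE.
apply: is_derive_eq; rewrite /= addr0 derivD derivC addr0 derivM derivX !hornerE.
rewrite /GRing.scale /=.
by field.
Qed.

Lemma is_derive_mul_horner_inv (K : numFieldType) (p : {poly K}) (xi : K -> K)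
    (dxi x : K) : x != 0 -> is_derive x 1 xi dxi ->
  is_derive x 1 (fun y => xi y * p.[y^-1])
    (dxi * p.[x^-1] - xi x * p^`().[x^-1] / x ^+ 2).
Proof.
move=> x0 dx; have dp := is_derive_horner_inv _ p x x0.
rewrite (_ : (fun _ => _) = xi * (fun y => p.[y^-1])); last exact/funext.
by apply: is_derive_eq; rewrite /GRing.scale /=; ring.
Qed.

(** Since $\xi'=\rho\xi$, one has $\xi''=(\rho^2+\rho')\xi$, so every derivative keeps the factor
    $\xi$. Openness of [D] makes the formula for the first derivative hold near each point, so that
    it can be differentiated again. *)
Lemma derive1_mul_horner_inv (K : numFieldType) (D : set K) (p : {poly K})
    (xi rho drho : K -> K) : open D -> ~ D 0 ->
  (forall z, D z -> is_derive z 1 xi (rho z * xi z)) ->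
  (forall z, D z -> is_derive z 1 rho (drho z)) ->
  let phi := fun z => xi z * p.[z^-1] in
  forall z, D z ->
  [/\ derivable phi z 1, derivable phi^`()%classic z 1,
      phi^`()%classic z = xi z * (rho z * p.[z^-1] - p^`().[z^-1] / z ^+ 2)
    & phi^`()^`()%classic z
      = xi z * ((rho z ^+ 2 + drho z) * p.[z^-1]
                + 2 * (1 - z * rho z) * p^`().[z^-1] / z ^+ 3
                + p^`()^`().[z^-1] / z ^+ 4)].
Proof.
move=> oD D0 dxi drh phi.
have n0 z : D z -> z != 0 by move=> Dz; apply/eqP => z0; apply: D0; rewrite -z0.
have d1 z : D z -> is_derive z 1 phi
    (xi z * (rho z * p.[z^-1] - p^`().[z^-1] / z ^+ 2)).
  move=> Dz; have := is_derive_mul_horner_inv _ p _ _ _ (n0 z Dz) (dxi z Dz).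
  by move/is_derive_eq; apply; ring.
(* The first derivative, written as a difference of two products of the same type, with gauges
   $\rho\xi$ and $\xi/z^2$, so that the product rule above applies to each. *)
pose psi z := (rho z * xi z) * p.[z^-1] - (xi z * (z ^-1 * z^-1)) * p^`().[z^-1].
have d2 z : D z -> is_derive z 1 psi
     (xi z * ((rho z ^+ 2 + drho z) * p.[z^-1]
                + 2 * (1 - z * rho z) * p^`().[z^-1] / z ^+ 3
                + p^`()^`().[z^-1] / z ^+ 4)).
  move=> Dz; have z0 := n0 z Dz.
  have dV := is_derive_invr _ _ z0; have dx := dxi z Dz; have dr := drh z Dz.
  have e1 := @is_derive_mul_horner_inv _ p (rho * xi) _ _ z0 (is_deriveM _ _).
  have e2 := @is_derive_mul_horner_inv _ p^`() (xi * (GRing.inv * GRing.inv)) _ _ z0 (is_deriveM _ _).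
  rewrite (_ : psi = (fun z => (rho * xi) z * p.[z^-1])
    - (fun z => (xi * (GRing.inv * GRing.inv)) z * p^`().[z^-1])); last exact/funext.
  apply: is_derive_eq; rewrite /GRing.scale /= !fctE /=.
  by field.
have near_psi z : D z -> \near z, psi z = phi^`()%classic z.
  move=> Dz; near=> y.
  have Dy : D y by near: y; exact: open_nbhs_nbhs.
  have y0 := n0 _ Dy.
  by rewrite derive1E (@derive_val _ _ _ _ _ _ _ (d1 y Dy)) /psi; field.
move=> z Dz; split.
- by have [] := d1 z Dz.
- have [dp _] := d2 z Dz; exact: near_eq_derivable (near_psi z Dz) dp.
- by rewrite derive1E (@derive_val _ _ _ _ _ _ _ (d1 z Dz)).
- by rewrite derive1E -(near_eq_derive _ (near_psi z Dz)) (@derive_val _ _ _ _ _ _ _ (d2 z Dz)).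
Unshelve. all: by end_near.
Qed.

(** * Real calculus along lines in the complex plane *)

Lemma continuous_Re (R : realType) : continuous ((fun z => Re z) : Cplx R -> R).
Proof.
move=> x; have FF : Filter (nbhs x) by exact: nbhs_filter.
apply/cvgrPdist_lt => e e0.
have : \forall t \near x, `|x - t| < RtoC e.
  by apply/nbhs_normP; exists (RtoC e) => //=; rewrite ltcR.
apply: filterS => t xt; rewrite -ltcR; apply: le_lt_trans xt.
by rewrite -raddfB; exact: normc_ge_Re.
Qed.

Lemma continuous_RtoC (R : realType) : continuous ((fun x => RtoC x) : R -> Cplx R).
Proof.
move=> x; apply/cvgrPdist_lt => -[e i].
(* A positive radius in the order of the complex field has zero imaginary part. *)
rewrite ltcE /= => /andP[/eqP -> e0].
have : \forall t \near x, `|x - t| < e by apply/nbhs_normP; exists e.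
apply: filterS => t xt; rewrite /RtoC -rmorphB normc_def /= expr0n /= addr0 sqrtr_sqr.
by rewrite ltcR.
Qed.

(** The real difference quotient is the real part of the complex one in direction [v], restricted to
    real increments. *)
Lemma is_derive_Re_line (R : realType) (f : Cplx R -> Cplx R) (z l v : Cplx R) :
  is_derive z 1 f l ->
  is_derive (0 : R) 1 (fun t : R => Re (f (RtoC t * v + z))) (Re (l * v)).
Proof.
move=> [df dfl].
have cv : (fun h : Cplx R => h^-1 *: (f (h *: v + z) - f z)) @ 0^' --> v * l.
  have dfz : differentiable f z by exact/derivable1_diffP.
  have -> : v * l = 'D_v f z by rewrite deriveE // diff1E // derive1E dfl.
  exact: diff_derivable.
(* Continuity alone is not enough for punctured neighbourhoods: injectivity of [RtoC] keeps nonzero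
   increments nonzero. *)
have cR : RtoC t @[t --> (0 : R)^'] --> (0 : Cplx R)^'.
  move=> A A0.
  have : nbhs (RtoC (0 : R)) [set t : Cplx R | t != 0 -> A t] by exact: A0.
  move=> /(continuous_RtoC R 0 _) A1.
  have A2 : nbhs (0 : R) [set t | RtoC t != 0 -> A (RtoC t)] by exact: A1.
  suff : nbhs (0 : R) [set t : R | t != 0 -> A (RtoC t)] by [].
  by apply: filterS A2 => t /= At t0; apply: At; rewrite fmorph_eq0.
(* The literal shape of the difference quotient at 0 in direction 1. *)
pose q (t : R) := t^-1 *:
  (Re (f (RtoC (t *: (1 : R) + 0) * v + z)) - Re (f (RtoC 0 * v + z))).
have cF : q @ 0^' --> Re (l * v).
  have -> : q
    = (fun x => Re x) \o (fun h : Cplx R => h^-1 *: (f (h *: v + z) - f z)) \o (fun t => RtoC t).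
    apply/funext => t; rewrite /q /= addr0 [t *: _]mulr1 mul0r add0r.
    rewrite -fmorphV /GRing.scale /= -raddfB /=.
    by case: (_ - _) => a b /=; rewrite mul0r subr0.
  rewrite mulrC; have c1 := cvg_comp _ _ cR cv.
  exact: cvg_comp c1 (continuous_Re R (v * l)).
apply: DeriveDef.
  by apply/cvg_ex; exists (Re (l * v)).
exact: cvg_lim cF.
Qed.

Definition sqmod (R : realType) (z : Cplx R) : R := Re z ^+ 2 + Im z ^+ 2.

(** The Euclidean inner product of the plane, $\mathrm{Re}(\bar z w)$. *)
Definition redot (R : realType) (z w : Cplx R) : R := Re z * Re w + Im z * Im w.

Lemma is_derive_sqmod_line (R : realType) (f : Cplx R -> Cplx R) (z l v : Cplx R) :
  is_derive z 1 f l ->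
  is_derive (0 : R) 1 (fun t : R => sqmod R (f (RtoC t * v + z)))
    (2 * redot R (f z) (l * v)).
Proof.
(* Multiplication by $-i$ turns imaginary parts into real parts, so the previous lemma covers
   both. *)
move=> df; pose mi : Cplx R := (0 +i* -1)%C.
have ImE (w : Cplx R) : Im w = Re (mi * w).
  by case: w => a b /=; rewrite mul0r mulN1r opprK add0r.
have d1 := is_derive_Re_line R f z l v df.
have d2 : is_derive z 1 (fun y => mi * f y) (mi * l) by exact: is_deriveZ.
have {}d2 := is_derive_Re_line R _ z _ v d2.
rewrite (_ : (fun t : R => _) = (fun t : R => Re (f (RtoC t * v + z))) ^+ 2
  + (fun t : R => Re (mi * f (RtoC t * v + z))) ^+ 2); last first.
  by apply/funext => t; rewrite /sqmod ImE.
apply: is_derive_eq.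
rewrite /redot !ImE /GRing.scale /= mul0r add0r -!mulrA.
by ring.
Qed.

(** * Differentiation of pointwise branches of powers *)

Lemma sqmod_cexp (R : realType) (w : Cplx R) : sqmod R (cexp w) = expR (2 * Re w).
Proof.
case: w => x y; rewrite /sqmod /= !exprMn -mulrDr cos2Dsin2 mulr1.
by rewrite expRM_natl.
Qed.

Lemma cexp_neq0 (R : realType) (w : Cplx R) : cexp w != 0.
Proof.
apply/eqP => w0; have := sqmod_cexp R w; rewrite w0 /sqmod /= expr0n addr0 => /esym.
by apply/eqP; rewrite gt_eqF ?expR_gt0.
Qed.

(** For real [s], $|e^{sw}|^2=e^{2s\,\mathrm{Re}\,w}$ depends on the logarithm [w] only through its
    real part, which $|g(z)|$ determines. *)
Lemma sqmod_power_branch (R : realType) D (g f : Cplx R -> Cplx R) s z :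
  power_branch D g s f -> D z ->
  0 < sqmod R (g z) /\ sqmod R (f z) = expR (s * ln (sqmod R (g z))).
Proof.
move=> [_ fg] /fg[w [<- ->]]; rewrite !sqmod_cexp expR_gt0 expRK; split => //.
by congr expR; case: w => x y /=; rewrite mul0r subr0 mulrCA.
Qed.

Lemma redot_mulr (R : realType) (z w : Cplx R) :
  redot R z (w * z) = sqmod R z * Re w.
Proof. by case: z w => a b [c d]; rewrite /redot /sqmod /=; ring. Qed.

Lemma Re_RtoCM (R : realType) (s : R) (w : Cplx R) : Re (RtoC s * w) = s * Re w.
Proof. by case: w => a b /=; rewrite mul0r subr0. Qed.

Lemma Re_divr (R : realType) (w z : Cplx R) :
  Re (w / z) = (sqmod R z)^-1 * redot R z w.
Proof. by case: z w => a b [c d]; rewrite /redot /sqmod /=; ring. Qed.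

(** The directions $1$ and $i$ recover the real and imaginary parts of $\bar z w$, and $\bar z$
    cancels. *)
Lemma redot_eq (R : realType) (z w w' : Cplx R) :
  z != 0 -> (forall v, redot R z (w * v) = redot R z (w' * v)) -> w = w'.
Proof.
case: z w w' => a b [c d] [c' d'] z0 h.
have := h 1; have := h (0 +i* 1)%C; rewrite /redot /= => h1 h2.
have n0 : a ^+ 2 + b ^+ 2 != 0.
  apply: contra z0; rewrite paddr_eq0 ?sqr_ge0 // !sqrf_eq0.
  by move=> /andP[/eqP -> /eqP ->].
(* The two equations are linear in the parts of [w], with determinant $a^2+b^2$; the combinations
   below are Cramer's rule. *)
congr (_ +i* _)%C; apply: (mulfI n0).
  transitivity (a * (a * (c * 1 - d * 0) + b * (c * 0 + d * 1))
    + b * (a * (c * 0 - d * 1) + b * (c * 1 + d * 0))); first by ring.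
  by rewrite h1 h2; ring.
transitivity (b * (a * (c * 1 - d * 0) + b * (c * 0 + d * 1))
  - a * (a * (c * 0 - d * 1) + b * (c * 1 + d * 0))); first by ring.
by rewrite h1 h2; ring.
Qed.

Lemma is_derive_power_branch (R : realType) D (g f : Cplx R -> Cplx R) s z dg :
  open D -> power_branch D g s f -> D z -> is_derive z 1 g dg ->
  is_derive z 1 f (RtoC s * dg / g z * f z).
Proof.
move=> oD pf Dz dgz.
have [hf _] := pf; have df := derivableP (hf z Dz).
have [gz0 fz] := sqmod_power_branch R D g f s z pf Dz.
suff E : 'D_1 f z = RtoC s * dg / g z * f z by rewrite -E.
have fz0 : f z != 0 by have [_ /(_ z Dz) [w [_ ->]]] := pf; exact: cexp_neq0.
apply: (redot_eq R (f z)) => // v.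
have lhs := is_derive_sqmod_line R f z _ v df.
have dN := is_derive_sqmod_line R g z _ v dgz.
pose N t := sqmod R (g (RtoC t * v + z)).
have N0 : N 0 = sqmod R (g z) by rewrite /N mul0r add0r.
have rhs : is_derive (0 : R) 1 (fun t => expR (s * ln (N t)))
    (expR (s * ln (N 0)) * (s * ((N 0)^-1 * (2 * redot R (g z) (dg * v))))).
  have dl : is_derive (N 0) 1 (@ln R) (N 0)^-1 by apply: is_derive1_ln; rewrite N0.
  have d1 : is_derive (0 : R) 1 (@ln R \o N) ((N 0)^-1 * (2 * redot R (g z) (dg * v))).
    by apply: is_derive1_comp.
  have d2 := is_deriveZ s d1.
  by apply: (@is_derive1_comp _ expR (s \*: (@ln R \o N))).
(* The modulus identity is known on [D] only; openness keeps the line inside [D] for small [t]. *)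
have eqN : \forall t \near (0 : R), sqmod R (f (RtoC t * v + z)) = expR (s * ln (N t)).
  have cl : RtoC t * v + z @[t --> (0 : R)] --> RtoC (0 : R) * v + z.
    apply: cvgD; last exact: cvg_cst.
    by apply: cvgM; [exact: continuous_RtoC | exact: cvg_cst].
  have : nbhs (RtoC (0 : R) * v + z) D.
    by rewrite mul0r add0r; exact: open_nbhs_nbhs.
  move=> /cl Dl; have {}Dl : nbhs (0 : R) [set t | D (RtoC t * v + z)] by [].
  by apply: filterS Dl => t /(sqmod_power_branch R D g f s _ pf)[].
have := @derive_val _ _ _ _ _ _ _ lhs.
rewrite (near_eq_derive _ eqN) (@derive_val _ _ _ _ _ _ _ rhs) N0 -fz.
move=> E.
(* With [f z] as the last factor, the inner product with [f z] becomes $|f|^2$ times a real part. *)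
have -> : RtoC s * dg / g z * f z * v = (RtoC s * (dg * v / g z)) * f z by ring.
rewrite redot_mulr Re_RtoCM Re_divr.
have two0 : (2 : R) != 0 by [].
by apply: (mulfI two0); rewrite -E; ring.
Qed.

(** * HR polynomials: differential equation, non-vanishing, Laurent form *)

Lemma HR_poly_ode (F : numFieldType) n (a b w : F) : HR_well_defined n a b ->
  let p := HR_poly n a b in
  w * (1 - w) * p^`()^`().[w] + (1 - b - n%:R - (a + 2 - n%:R) * w) * p^`().[w]
  + n%:R * (a + 1) * p.[w] = 0.
Proof.
move=> [_ wd] p.
have c0 j : (j < n)%N -> 1 - b - n%:R + j%:R != 0.
  (* $1-b-n+j=0$ means $b=-(n-1-j)$, one of the excluded values. *)
  move=> jn; apply/eqP => e0; apply: (wd (n - j.+1)%N); first by rewrite ltn_subrL (leq_ltn_trans _ jn).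
  rewrite natrB // -natr1; apply/eqP; rewrite -subr_eq0 -oppr_eq0; apply/eqP.
  by rewrite -[RHS]e0; ring.
have /= e0 := congr1 (horner^~ w) (hyp2F1_neg_ode F n (a + 1) _ c0).
rewrite !(hornerD, hornerM, hornerN, hornerC, hornerX) in e0.
rewrite /p /HR_poly !derivZ !hornerZ.
set k := _ / _; rewrite -[RHS](mulr0 k) -e0; ring.
Qed.

(** The series has constant term 1, and well-definedness makes the normalizing quotient nonzero. *)
Lemma HR_poly_neq0 (F : fieldType) n (a b : F) :
  HR_well_defined n a b -> HR_poly n a b != 0.
Proof.
move=> [a0 wd]; rewrite /HR_poly scaler_eq0 negb_or mulf_neq0 /=.
- apply/eqP => /(congr1 (fun q : {poly F} => q`_0)).
  rewrite coef_poly /= /pochhammer !big_ord0 coef0 !mul1r invr1 => /eqP.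
  by rewrite oner_eq0.
- apply: pochhammer_neq0 => k kn; apply/eqP => /eqP; rewrite addr_eq0 => /eqP.
  exact: wd.
- by rewrite invr_eq0; apply/eqP.
Qed.

(** Reversing the coefficients gives the numerator. Using [size p], one more than the degree of a
    nonzero [p], pads it with a harmless zero and avoids a separate case for [p = 0]. *)
Lemma horner_inv_revE (K : fieldType) (p : {poly K}) (z : K) : z != 0 ->
  p.[z^-1] = (\poly_(i < (size p).+1) p`_(size p - i)).[z] / z ^+ size p.
Proof.
move=> z0; rewrite horner_poly (@horner_coef_wide _ (size p).+1) //.
rewrite mulr_suml (reindex_inj rev_ord_inj) /=; apply: eq_bigr => i _.
rewrite subSS -mulrA; congr (_ * _).
have ip : (i <= size p)%N by rewrite -ltnS.
by rewrite exprVn exprB ?unitfE // invf_div.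
Qed.

Lemma Laurent_polynomial_horner_inv (R : realType) (p : {poly Cplx R}) :
  Laurent_polynomial (fun z => p.[z^-1]).
Proof. by exists (size p); eexists => z; exact: horner_inv_revE. Qed.

(** Otherwise the inverses of [size p] distinct points of [D] would all be roots of [p], too many
    for its degree. *)
Lemma open_nonroot_inv (K : numFieldType) (D : set K) (p : {poly K}) :
  open D -> D !=set0 -> ~ D 0 -> p != 0 -> exists2 z, D z & p.[z^-1] != 0.
Proof.
move=> oD [z Dz] D0 p0; apply: contrapT => noroot.
have rootD y : D y -> root p y^-1.
  by move=> Dy; apply/negPn/negP => py; apply: noroot; exists y.
have /nbhs_normP[e /= e0 eD] : nbhs z D by exact: open_nbhs_nbhs.
(* The denominator starts at 2, so that even [u 0] lies strictly inside the ball of radius [e]. *)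
pose u (k : nat) : K := z + e / k.+2%:R.
have Du k : D (u k).
  apply: eD; rewrite /ball_ /= /u opprD addrA subrr add0r normrN.
  by rewrite gtr0_norm ?divr_gt0 // ltr_pdivrMr // ltr_pMr // ltr1n.
have uI : injective u.
  move=> i j /addrI /(mulfI (lt0r_neq0 e0)) /invr_inj /eqP.
  by rewrite eqr_nat => /eqP[].
have rs : all (root p) [seq (u k)^-1 | k <- iota 0 (size p)].
  by apply/allP => _ /mapP[k _ ->]; exact: rootD (Du k).
have us : uniq [seq (u k)^-1 | k <- iota 0 (size p)].
  by rewrite map_inj_uniq ?iota_uniq // => i j /invr_inj /uI.
by have := max_poly_roots p0 rs us; rewrite size_map size_iota ltnn.
Qed.

(** * Reduction to an identity free of the gauge *)

Lemma quasi_Laurent_of_ode (R : realType) (D : set (Cplx R)) alpha beta theta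
    (xi rho drho : Cplx R -> Cplx R) (p : {poly Cplx R}) :
  complex_domain D -> ~ D 0 -> p != 0 ->
  (forall z, D z -> xi z != 0) ->
  (forall z, D z -> is_derive z 1 xi (rho z * xi z)) ->
  (forall z, D z -> is_derive z 1 rho (drho z)) ->
  (forall z, D z -> z != 0 ->
     z * (1 - z) * ((rho z ^+ 2 + drho z) * p.[z^-1]
                + 2 * (1 - z * rho z) * p^`().[z^-1] / z ^+ 3
                + p^`()^`().[z^-1] / z ^+ 4)
     + (1 - RtoC beta - (2 + RtoC alpha) * z - theta * (1 - z))
       * (rho z * p.[z^-1] - p^`().[z^-1] / z ^+ 2)
     + theta * (RtoC alpha + 1) * p.[z^-1] = 0) ->
  quasi_Laurent_eigenfunction D (L1 alpha beta) (L2 alpha) theta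
    xi (fun z => p.[z^-1]).
Proof.
move=> [nD oD _] D0 p0 xi0 dxi drh ode.
have D' := derive1_mul_horner_inv _ D p xi rho drho oD D0 dxi drh.
split.
- by split=> z Dz; [have [] := dxi z Dz | apply/eqP; exact: xi0].
- exact: Laurent_polynomial_horner_inv.
- split.
  + by split=> z /D'[].
  + have [z Dz pz] := open_nonroot_inv _ D p oD nD D0 p0.
    by exists z => //; apply/eqP; rewrite mulf_neq0 // xi0.
  + move=> z Dz; have [_ _ E1 E2] := D' z Dz.
    have z0 : z != 0 by apply/eqP => e; apply: D0; rewrite -e.
    (* Every term carries the factor [xi z]; removing it leaves the assumed identity. *)
    rewrite /L1 /L2 E1 E2 -[RHS](mulr0 (xi z)) -(ode z Dz z0).
    by ring.
Qed.

(** * The two gauges and their logarithmic derivatives *)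

Lemma HR_gauge3_ode (F : numFieldType) n (a b z : F) :
  HR_well_defined n a b -> z != 0 ->
  let p := HR_poly n a b in
  let rho := (- 1 - a) * z^-1 in
  let theta := - n%:R - 1 - a - b in
  z * (1 - z) * ((rho ^+ 2 + (- 1 - a) * - z ^- 2) * p.[z^-1]
             + 2 * (1 - z * rho) * p^`().[z^-1] / z ^+ 3
             + p^`()^`().[z^-1] / z ^+ 4)
  + (1 - b - (2 + a) * z - theta * (1 - z))
    * (rho * p.[z^-1] - p^`().[z^-1] / z ^+ 2)
  + theta * (a + 1) * p.[z^-1] = 0.
Proof.
move=> wd z0 p rho theta; have := HR_poly_ode _ n _ _ z^-1 wd; rewrite -/p => /=.
rewrite /rho /theta.
(* With the values at $1/z$ taken as free variables, an identity of rational functions in [z]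
   remains. *)
move: p.[_] p^`().[_] p^`()^`().[_] => P0 P1 P2 ode.
by rewrite -[RHS](mulr0 (- z^-1)) -ode; field.
Qed.

(** Here [rho] belongs to $(-z)^{-1+b}(1-z)^{-a-b}$; the derivative $-1$ of $1-z$ turns the exponent
    $-a-b$ into the coefficient $a+b$. *)
Lemma HR_gauge4_ode (F : numFieldType) n (a b z : F) :
  HR_well_defined n (- b) (- a) -> z != 0 -> 1 - z != 0 ->
  let p := HR_poly n (- b) (- a) in
  let rho := (- 1 + b) * z^-1 + (a + b) * (1 - z)^-1 in
  let theta := - n%:R - 1 in
  z * (1 - z) * ((rho ^+ 2 + ((- 1 + b) * - z ^- 2 + (a + b) * (1 - z) ^- 2))
                   * p.[z^-1]
             + 2 * (1 - z * rho) * p^`().[z^-1] / z ^+ 3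
             + p^`()^`().[z^-1] / z ^+ 4)
  + (1 - b - (2 + a) * z - theta * (1 - z))
    * (rho * p.[z^-1] - p^`().[z^-1] / z ^+ 2)
  + theta * (a + 1) * p.[z^-1] = 0.
Proof.
move=> wd z0 z1 p rho theta; have := HR_poly_ode _ n _ _ z^-1 wd; rewrite -/p => /=.
rewrite /rho /theta.
move: p.[_] p^`().[_] p^`()^`().[_] => P0 P1 P2 ode.
rewrite -[RHS](mulr0 (- z^-1)) -ode; field.
by rewrite z0 z1.
Qed.

Lemma is_derive_scale_invr (K : numFieldType) (k x : K) :
  x != 0 -> is_derive x 1 (fun y => k * y^-1) (k * - x ^- 2).
Proof. by move=> x0; apply: is_deriveZ; exact: is_derive_invr. Qed.

Lemma is_derive_1B (K : numFieldType) (x : K) :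
  is_derive x 1 (fun y => 1 - y) (- 1).
Proof.
rewrite (_ : (fun y => 1 - y) = cst 1 - id); last exact/funext.
by apply: is_derive_eq; rewrite sub0r.
Qed.

Lemma is_derive_scale_inv1B (K : numFieldType) (k x : K) :
  1 - x != 0 -> is_derive x 1 (fun y => k * (1 - y)^-1) (k * (1 - x) ^- 2).
Proof.
move=> x1; have [d1 d2] := is_derive_1B K x.
have dV : is_derive x 1 (fun y => (1 - y)^-1) ((1 - x) ^- 2).
  apply: DeriveDef; first exact: derivableV.
  by rewrite deriveV // d2 /GRing.scale /= mulrN1 opprK.
exact: is_deriveZ.
Qed.

Theorem mainTheorem6 (R : realType) (alpha beta : R) (n : nat)
  (wd3 : HR_well_defined n (RtoC alpha) (RtoC beta))
  (wd4 : HR_well_defined n (- RtoC beta) (- RtoC alpha)) :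
  (forall (D : set (Cplx R)) (xi3 : Cplx R -> Cplx R),
     complex_domain D -> ~ D 0 ->
     power_branch D (fun z => - z) (- 1 - alpha) xi3 ->
     quasi_Laurent_eigenfunction D (L1 alpha beta) (L2 alpha)
       (- n%:R - 1 - RtoC alpha - RtoC beta)
       xi3
       (fun z => (HR_poly n (RtoC alpha) (RtoC beta)).[z^-1]))
  /\
  (forall (D : set (Cplx R)) (f g : Cplx R -> Cplx R),
     complex_domain D -> ~ D 0 -> ~ D 1 ->
     power_branch D (fun z => - z) (- 1 + beta) f ->
     power_branch D (fun z => 1 - z) (- alpha - beta) g ->
     quasi_Laurent_eigenfunction D (L1 alpha beta) (L2 alpha)
       (- n%:R - 1)
       (fun z => f z * g z)
       (fun z => (HR_poly n (- RtoC beta) (- RtoC alpha)).[z^-1])).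
Proof.
have RB (x y : R) : RtoC (x - y) = RtoC x - RtoC y by exact: rmorphB.
have RD (x y : R) : RtoC (x + y) = RtoC x + RtoC y by exact: rmorphD.
have RN (x : R) : RtoC (- x) = - RtoC x by exact: rmorphN.
have R1 : RtoC (- 1 : R) = - 1 by rewrite RN.
have n0 (D : set (Cplx R)) z : ~ D 0 -> D z -> z != 0.
  by move=> D0 Dz; apply/eqP => z0; apply: D0; rewrite -z0.
split.
- move=> D xi3 cD D0 pb; have [_ oD _] := cD.
  refine (quasi_Laurent_of_ode R D alpha beta _ xi3
    (fun z => (- 1 - RtoC alpha) * z^-1)
    (fun z => (- 1 - RtoC alpha) * - z ^- 2) _ cD D0 (HR_poly_neq0 _ _ _ _ wd3) _ _ _ _).
  + by move=> z Dz; have [_ /(_ z Dz) [w [_ ->]]] := pb; exact: cexp_neq0.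
  + move=> z Dz; have z0 := n0 D z D0 Dz.
    (* The signs cancel in $g'/g$ for $g(z)=-z$, leaving $1/z$. *)
    have := is_derive_power_branch _ _ _ _ _ _ _ oD pb Dz (is_deriveNid _ _).
    by move/is_derive_eq; apply; rewrite RB R1; field.
  + by move=> z Dz; apply: is_derive_scale_invr; exact: n0 Dz.
  + by move=> z Dz z0; exact: HR_gauge3_ode.
- move=> D f g cD D0 D1 pf pg; have [_ oD _] := cD.
  have n1 z : D z -> 1 - z != 0.
    by move=> Dz; rewrite subr_eq0; apply/eqP => z1; apply: D1; rewrite z1.
  refine (quasi_Laurent_of_ode R D alpha beta _ (fun z => f z * g z)
    (fun z => (- 1 + RtoC beta) * z^-1 + (RtoC alpha + RtoC beta) * (1 - z)^-1)
    (fun z => (- 1 + RtoC beta) * - z ^- 2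
              + (RtoC alpha + RtoC beta) * (1 - z) ^- 2)
    _ cD D0 (HR_poly_neq0 _ _ _ _ wd4) _ _ _ _).
  + move=> z Dz; have [_ /(_ z Dz) [w [_ ->]]] := pf.
    by have [_ /(_ z Dz) [w' [_ ->]]] := pg; rewrite mulf_neq0 // cexp_neq0.
  + move=> z Dz; have z0 := n0 D z D0 Dz; have z1 := n1 z Dz.
    have d1 := is_derive_power_branch _ _ _ _ _ _ _ oD pf Dz (is_deriveNid _ _).
    have d2 := is_derive_power_branch _ _ _ _ _ _ _ oD pg Dz (is_derive_1B _ _).
    (* By the product rule, the logarithmic derivatives of the two branches add up. *)
    have := is_deriveM d1 d2.
    move/is_derive_eq; apply; rewrite RB RN RD R1 /GRing.scale /=; field.
    by rewrite z0 z1.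
  + move=> z Dz; apply: is_deriveD.
      by apply: is_derive_scale_invr; exact: n0 Dz.
    by apply: is_derive_scale_inv1B; exact: n1.
  + by move=> z Dz z0; apply: HR_gauge4_ode => //; exact: n1.
Qed.
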